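(* Let $r,s,\ell,k,m$ be positive integers with $r\ge s$, $\ell\ge k$, $r\ge\ell$, $s\ge k$, and $k\ell\le m\le rs$. Let $G=G[U,W]$ be a bipartite graph with parts $U$ and $W$, $|U|=r$, $|W|=s$, and exactly $m$ edges. Suppose that there exists a subset $I\subseteq U$ with $|I|=\ell$ and $\delta_G(I)\ge k$. Then $$N(S_2,G)\le\begin{cases} N\big(S_2,B_1(r,s,m,\ell,k)\big), & \text{if } m\le rk \text{ and } k+\ell\le r,\\ N\big(S_2,B_2(r,s,m,\ell,k)\big), & \text{if } m\le rk \text{ and } k+\ell>r,\\ N\big(S_2,B(r,s,m)\big), & \text{if } m\ge rk.\end{cases}$$
   Context: All graphs are finite and simple. $S_2$ denotes the star with two edges. $N(S_2,G)$ is the number of (not necessarily induced) subgraphs of $G$ isomorphic to $S_2$, i.e. $N(S_2,G)=\sum_{v\in V(G)}\binom{d_G(v)}{2}$, where $d_G(v)$ is the degree of $v$. For $S\subseteq V(G)$, $\delta_G(S)=\min\{d_G(v):v\in S\}$. For a positive integer $t$, $[t]=\{1,\dots,t\}$, $[0]=\emptyset$, and for integers $a\le b$, $[a,b]=\{a,\dots,b\}$, with $[a,b]=\emptyset$ if $a>b$. All of the following bipartite graphs have parts $\{u_1,\dots,u_r\}$ and $\{w_1,\dots,w_s\}$. - $B(r,s,m)$, for $m\le rs$ and $r\ge s$: write $m=rp+q$ with integers $p\ge0$, $0\le q\le r-1$. The edge set is $\{\{u_i,w_j\}:(i,j)\in[r]\times[p]\}\cup\{\{u_i,w_{p+1}\}: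 i\in[q]\}$. - $B_1(r,s,m,\ell,k)$, for $r\ge\ell$, $s\ge k$, $k\ell\le m\le rk$ (used when $r>\ell$): write $m=k\ell+p(r-\ell)+q$ with integers $p\ge0$, $0\le q\le r-\ell-1$. The edge set is the union of $\{\{u_i,w_j\}:(i,j)\in[r]\times[p]\}$, $\{\{u_i,w_{p+1}\}:i\in[\ell+q]\}$ (this second set is omitted if $p=k$, which happens only when $m=rk$), and $\{\{u_i,w_j\}:(i,j)\in[\ell]\times[p+2,k]\}$. - $B_2(r,s,m,\ell,k)$, for $r\ge\ell$, $s\ge k$, $k\ell\le m\le rk$: write $m=k\ell+pk+q$ with integers $p\ge0$, $0\le q\le k-1$. The edge set is $\{\{u_i,w_j\}:(i,j)\in[\ell+p]\times[k]\}\cup\{\{u_{\ell+p+1},w_i\}:i\in[q]\}$. *)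

(* Defs.v *)
From mathcomp Require Import all_boot.

Set Implicit Arguments.
Unset Strict Implicit.
Unset Printing Implicit Defensive.

Record sgraph := SGraph {
  vertex :> finType;
  adj : rel vertex;
  adj_sym : symmetric adj;
  adj_irr : irreflexive adj }.

Section Graphs.
Variable G : sgraph.
Implicit Types (U W S A : {set G}) (v : G).

Definition edges : {set {set G}} :=
  [set e : {set G} | [exists x : G, exists y : G, adj x y && (e == [set x; y])]].

Definition deg v : nat := #|[set w : G | adj v w]|.

(* The default #|G| exceeds every degree, so on a nonempty S this is the
   minimum of the degrees (and only nonempty S are meaningful). *)
Definition min_deg S : nat := \big[minn/#|G|]_(v in S) deg v.

Definition bipartition U W : Prop :=
  [/\ U :|: W = [set: G], [disjoint U & W]
    & forall x y : G, adj x y ->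
        (x \in U /\ y \in W) \/ (x \in W /\ y \in U)].

(* A subgraph is a pair (vertex set, edge set). *)
Definition is_subgraph (X : {set G} * {set {set G}}) : bool :=
  (X.2 \subset edges) && [forall e in X.2, e \subset X.1].

End Graphs.

Definition iso_to (H G : sgraph) (X : {set G} * {set {set G}}) : bool :=
  [exists f : {ffun H -> G},
    [&& injectiveb f, X.1 == f @: [set: H]
      & X.2 == [set f @: (e : {set H}) | e in edges H]]].

Definition num_copies (H G : sgraph) : nat :=
  #|[set X : {set G} * {set {set G}} | is_subgraph X && iso_to H X]|.

(* The star with t edges; ord0 is the centre. *)
Section Star.
Variable t : nat.

Definition star_adj : rel 'I_t.+1 := fun x y => (x == ord0) (+) (y == ord0).

Fact star_adj_sym : symmetric star_adj.
Proof. by move=> x y; rewrite /star_adj addbC. Qed.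

Fact star_adj_irr : irreflexive star_adj.
Proof. by move=> x; rewrite /star_adj addbb. Qed.

Definition star : sgraph := SGraph star_adj_sym star_adj_irr.
End Star.

(* The bipartite graph with parts {u_1..u_r} and {w_1..w_s}, where u_i w_j is
   an edge iff E i j. The vertex u_i is inl of the ordinal i - 1, and w_j is
   inr of the ordinal j - 1: E receives indices that start at 1. *)
Section BipGraph.
Variables (r s : nat) (E : nat -> nat -> bool).

Definition bip_adj : rel ('I_r + 'I_s)%type := fun x y =>
  match x, y with
  | inl i, inr j => E i.+1 j.+1
  | inr j, inl i => E i.+1 j.+1
  | _, _ => false
  end.

Fact bip_adj_sym : symmetric bip_adj.
Proof. by case=> i; case=> j. Qed.

Fact bip_adj_irr : irreflexive bip_adj.
Proof. by case. Qed.

Definition bip_graph : sgraph := SGraph bip_adj_sym bip_adj_irr.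
End BipGraph.

Definition B (r s m : nat) : sgraph :=
  let p := m %/ r in
  let q := m %% r in
  bip_graph r s (fun i j => (j <= p) || ((j == p.+1) && (i <= q))).

(* Meaningful for l < r, k <= s and k * l <= m <= r * k. *)
Definition B1 (r s m l k : nat) : sgraph :=
  let p := (m - k * l) %/ (r - l) in
  let q := (m - k * l) %% (r - l) in
  bip_graph r s (fun i j =>
    [|| j <= p,
        [&& p != k, j == p.+1 & i <= l + q]
      | (i <= l) && (p + 2 <= j <= k)]).

(* Meaningful for l <= r, 0 < k <= s and k * l <= m <= r * k. *)
Definition B2 (r s m l k : nat) : sgraph :=
  let p := (m - k * l) %/ k in
  let q := (m - k * l) %% k in
  bip_graph r s (fun i j =>
    ((i <= l + p) && (j <= k)) || ((i == (l + p).+1) && (j <= q))).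

(* N(S_2, G) in terms of degrees. *)
Section CountStar2.
Variable G : sgraph.

Let cherry (c : G * {set G}) : {set G} * {set {set G}} :=
  (c.1 |: c.2, [set [set c.1; x] | x in c.2]).

Let cherries : {set G * {set G}} :=
  [set c : G * {set G} | (c.2 \subset [set w | adj c.1 w])
                         && (#|c.2| == 2)].

Let cherry_inj : {in cherries &, injective cherry}.
Proof.
move=> [v B] [v' B']; rewrite !inE /= => /andP[sB cB] /andP[sB' _] [eA eF].
have vB : v \notin B.
  by apply/negP=> /(subsetP sB); rewrite inE adj_irr.
have vB' : v' \notin B'.
  by apply/negP=> /(subsetP sB'); rewrite inE adj_irr.
have [evv|nvv] := eqVneq v v'.
  subst v'; congr pair.
  by rewrite -(setU1K vB) eA setU1K.
have v'B : v' \in B.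
  have : v' \in v |: B by rewrite eA setU11.
  by rewrite !inE eq_sym (negbTE nvv).
have : 0 < #|B :\ v'| by move: cB; rewrite (cardsD1 v') v'B; case: #|_|.
case/card_gt0P=> z; rewrite !inE => /andP[zv' zB].
have : [set v; z] \in [set [set v'; x] | x in B'].
  by rewrite -eF; apply/imsetP; exists z.
case/imsetP=> x _ e.
have : v' \in [set v; z] by rewrite e set21.
by rewrite !inE eq_sym (negbTE nvv) eq_sym (negbTE zv').
Qed.

Let card_cherries : #|cherries| = \sum_(v : G) 'C(deg v, 2).
Proof.
rewrite -sum1_card.
transitivity (\sum_(v : G) \sum_(B : {set G} |
    (B \subset [set w | adj v w]) && (#|B| == 2)) 1).
  rewrite pair_big_dep /=.
  by apply: eq_bigl => c; rewrite inE.
apply: eq_bigr => v _; rewrite sum1dep_card -cards_draws.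
by apply: eq_card => B; rewrite !inE.
Qed.

Lemma num_copies_star2 :
  num_copies (star 2) G = \sum_(v : G) 'C(deg v, 2).
Proof.
rewrite -card_cherries -(card_in_imset cherry_inj); apply: eq_card => -[A F].
pose i1 : 'I_3 := inord 1; pose i2 : 'I_3 := inord 2.
have I3 (i : 'I_3) : [\/ i = ord0, i = i1 | i = i2].
  by case: i => [[|[|[|//]]] lt]; [constructor 1|constructor 2|constructor 3];
    apply: val_inj; rewrite //= inordK.
have n10 : i1 != ord0 by rewrite -val_eqE /= inordK.
have n20 : i2 != ord0 by rewrite -val_eqE /= inordK.
have n12 : i1 != i2 by rewrite -val_eqE /= !inordK.
have eE : edges (star 2) = [set [set ord0; i1]; [set ord0; i2]].
  apply/setP=> e; rewrite !inE; apply/idP/idP.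
    case/existsP=> x /existsP[y /andP[]]; rewrite /adj /= /star_adj => a /eqP->.
    case: (I3 x) a => ->; case: (I3 y) => ->;
      rewrite ?eqxx ?(negbTE n10) ?(negbTE n20) //= ?orbT // => _;
      by rewrite [[set _; ord0]]setUC eqxx ?orbT.
  case/orP=> /eqP->; apply/existsP; exists ord0; apply/existsP.
    by exists i1; rewrite /= /star_adj eqxx (negbTE n10) eqxx.
  by exists i2; rewrite /= /star_adj eqxx (negbTE n20) eqxx.
have sT : [set: 'I_3] = [set ord0; i1; i2].
  by apply/setP=> i; rewrite !inE; case: (I3 i) => ->; rewrite eqxx ?orbT.
rewrite !inE; apply/andP/imsetP.
- move=> [/andP[/= /subsetP sF _]] /existsP[f /and3P[/injectiveP fi /eqP /= eA /eqP /= eF]].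
  have e2 i : f @: [set ord0; i] = [set f ord0; f i] by rewrite imsetU1 imset_set1.
  have ad i : i \in [set i1; i2] -> adj (f ord0) (f i).
    move=> hi; have : [set f ord0; f i] \in edges G.
      apply: sF; rewrite eF -e2; apply: imset_f; rewrite eE !inE.
      by move: hi; rewrite !inE => /orP[]/eqP->; rewrite eqxx ?orbT.
    rewrite inE => /existsP[x /existsP[y /andP[axy /eqP e]]].
    have nxy : x != y by apply: contraTneq axy => ->; rewrite adj_irr.
    have : x \in [set f ord0; f i] by rewrite e set21.
    have : y \in [set f ord0; f i] by rewrite e set22.
    rewrite !inE => /orP[]/eqP yE /orP[]/eqP xE; subst x y; rewrite ?eqxx // in nxy *.
    by rewrite adj_sym.
  exists (f ord0, [set f i1; f i2]).
    rewrite inE /= cards2 (inj_eq fi) n12 andbT.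
    apply/subsetP=> w; rewrite !inE => /orP[]/eqP->; apply: ad;
      by rewrite !inE eqxx ?orbT.
  congr pair.
    by rewrite eA sT !imsetU !imset_set1 /= setUA.
  by rewrite eF eE /= !imsetU !imset_set1 !e2.
- case=> -[v B]; rewrite inE /= => /andP[sB /cards2P[x [y [nxy eB]]]] [-> ->].
  subst B.
  have ax : adj v x by have := subsetP sB x (set21 _ _); rewrite inE.
  have ay : adj v y by have := subsetP sB y (set22 _ _); rewrite inE.
  have nvx : v != x by apply: contraTneq ax => <-; rewrite adj_irr.
  have nvy : v != y by apply: contraTneq ay => <-; rewrite adj_irr.
  split.
    rewrite /is_subgraph /=; apply/andP; split.
      apply/subsetP=> e /imsetP[z /(subsetP sB)]; rewrite inE => az ->.
      rewrite inE; apply/existsP; exists v; apply/existsP; exists z.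
      by rewrite az eqxx.
    apply/forall_inP=> e /imsetP[z zB ->].
    apply/subsetP=> w; rewrite in_set2 => /orP[]/eqP->; first exact: setU11.
    exact: setU1r.
  pose f : {ffun star 2 -> G} :=
    [ffun i : 'I_3 => if i == ord0 then v else if i == i1 then x else y].
  have f0 : f ord0 = v by rewrite ffunE eqxx.
  have f1 : f i1 = x by rewrite ffunE (negbTE n10) eqxx.
  have f2 : f i2 = y by rewrite ffunE (negbTE n20) eq_sym (negbTE n12).
  apply/existsP; exists f; apply/and3P; split => /=.
  + apply/injectiveP=> i j.
    case: (I3 i) => ->; case: (I3 j) => ->; rewrite ?f0 ?f1 ?f2 // => /eqP;
      by rewrite ?(negbTE nvx) ?(negbTE nvy) ?(negbTE nxy)
         1?eq_sym ?(negbTE nvx) ?(negbTE nvy) ?(negbTE nxy).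
  + by rewrite sT !imsetU !imset_set1 f0 f1 f2 setUA.
  + by rewrite eE !imsetU !imset_set1 !imsetU !imset_set1 f0 f1 f2.
Qed.

End CountStar2.

(* Main.v *)
(* Replace G by the Young diagram whose (j+1)-th column counts the vertices of U
   of degree greater than j. Since two vertices of U have at most
   min(d(u), d(u')) common neighbours, this keeps the degrees in U and does not
   lower the sum of d^2 over W. For a Young diagram the number of 2-stars is the
   sum of i + j over its cells (i, j), indexed from 0.

   In an n x n box, this weight is at most that of the diagram filled by columns
   of height n: peel off a full row or a full column, or else pass to the
   (n-1) x (n-1) box.

   The same peeling shows that a diagram of area at most n k that contains an
   a x b rectangle can be moved, without losing weight, into n x k so as to
   contain an l x k rectangle, whenever a + b = l + k and k <= min(a, b): a full
   line removed from either side costs one unit of k and one of a or b. If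
   there is no full line and the area exceeds (n-1) k, then the box bound for
   n - 1 is at most the weight of rows of length k.

   What remains is to fill the (r-l) x k region below the l x k rectangle; by the
   box bound the best filling uses its longer side, which gives B_1 or B_2. *)
Require Import Defs.
From mathcomp Require Import all_boot zify.

Set Implicit Arguments.
Unset Strict Implicit.
Unset Printing Implicit Defensive.

(** * Sums over initial segments and binomials *)

Lemma sum_ord_widen (a b : nat) (f : nat -> nat) :
  a <= b -> (forall i, a <= i -> f i = 0) ->
  \sum_(i < b) f i = \sum_(i < a) f i.
Proof.
move=> /subnKC <- f0; rewrite big_split_ord /= [X in _ + X]big1 ?addn0 // => i _.
by apply: f0; apply: leq_addr.
Qed.

Lemma sum_ord_blocks (n c : nat) (f : nat -> nat) :
  \sum_(t < c * n) f t = \sum_(j < c) \sum_(i < n) f (j * n + i).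
Proof.
elim: c => [|c IHc]; first by rewrite mul0n !big_ord0.
by rewrite mulSnr big_split_ord big_ord_recr /= IHc.
Qed.

Lemma sum_ord_bin2 (n : nat) : \sum_(i < n) i = 'C(n, 2).
Proof. by rewrite -bin2_sum big_mkord. Qed.

Lemma bin2_sqr (n : nat) : 'C(n, 2) * 2 + n = n * n.
Proof. by elim: n => [|n IHn] //; rewrite binS bin1; lia. Qed.

(** A downward closed [P] holds on an initial segment, and the indices of the first d numbers add up
    to 'C(d, 2). This is how a degree becomes a sum over cells. *)
Lemma bin2_sum_prefix (n : nat) (P : nat -> bool) :
  (forall i j, i <= j -> P j -> P i) ->
  'C(\sum_(i < n) P i, 2) = \sum_(i < n) P i * i.
Proof.
move=> Pdown; elim: n => [|n IHn]; first by rewrite !big_ord0.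
rewrite !big_ord_recr /= -IHn.
case: (boolP (P n)) => [Pn|_]; last by rewrite mul0n !addn0.
have -> : \sum_(i < n) P i = n.
  rewrite (eq_bigr (fun _ => 1)) ?sum1_card ?card_ord // => i _.
  by rewrite (Pdown _ _ (ltnW (ltn_ord i)) Pn).
by rewrite addn1 mul1n binS bin1.
Qed.

(** * Young diagrams, their area and weight *)

(* Diagrams are indexed from 0. *)
Definition diagram := nat -> nat -> bool.

Definition young (y : diagram) : Prop :=
  forall i j i' j', i' <= i -> j' <= j -> y i j -> y i' j'.

Definition inside (a b : nat) (y : diagram) : Prop :=
  forall i j, y i j -> i < a /\ j < b.

Definition covers (a b : nat) (y : diagram) : Prop :=
  forall i j, i < a -> j < b -> y i j.

Definition transpose (y : diagram) : diagram := fun i j => y j i.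

Definition area (a b : nat) (y : diagram) : nat :=
  \sum_(i < a) \sum_(j < b) y i j.

Definition weight (a b : nat) (y : diagram) : nat :=
  \sum_(i < a) \sum_(j < b) y i j * (i + j).

Lemma area_tr (a b : nat) (y : diagram) : area b a (transpose y) = area a b y.
Proof. by rewrite /area exchange_big. Qed.

Lemma weight_tr (a b : nat) (y : diagram) : weight b a (transpose y) = weight a b y.
Proof.
rewrite /weight exchange_big; apply: eq_bigr => i _; apply: eq_bigr => j _.
by rewrite addnC.
Qed.

Lemma eq_area (a b : nat) (y z : diagram) :
  (forall i j, i < a -> j < b -> y i j = z i j) -> area a b y = area a b z.
Proof. by move=> e; apply: eq_bigr => i _; apply: eq_bigr => j _; rewrite e. Qed.

Lemma eq_weight (a b : nat) (y z : diagram) :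
  (forall i j, i < a -> j < b -> y i j = z i j) -> weight a b y = weight a b z.
Proof. by move=> e; apply: eq_bigr => i _; apply: eq_bigr => j _; rewrite e. Qed.

Lemma sum2_widen (a b a' b' : nat) (y : diagram) (f : nat -> nat -> nat) :
  inside a b y -> a <= a' -> b <= b' ->
  \sum_(i < a') \sum_(j < b') y i j * f i j = \sum_(i < a) \sum_(j < b) y i j * f i j.
Proof.
move=> iny leaa lebb.
have y0 i j : (a <= i) || (b <= j) -> y i j = false.
  by move=> h; apply/negP => /iny[]; lia.
rewrite (@sum_ord_widen a a' (fun i => \sum_(j < b') y i j * f i j)) //.
  apply: eq_bigr => i _.
  rewrite (@sum_ord_widen b b' (fun j => y i j * f i j)) // => j lebj.
  by rewrite y0 ?lebj ?orbT.
by move=> i leai; rewrite big1 // => j _; rewrite y0 ?leai.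
Qed.

Lemma weight_widen (a b a' b' : nat) (y : diagram) :
  inside a b y -> a <= a' -> b <= b' -> weight a' b' y = weight a b y.
Proof. exact: sum2_widen. Qed.

Lemma area_widen (a b a' b' : nat) (y : diagram) :
  inside a b y -> a <= a' -> b <= b' -> area a' b' y = area a b y.
Proof.
move=> iny leaa lebb; have := sum2_widen (fun _ _ => 1) iny leaa lebb.
by congr (_ = _); apply: eq_bigr => i _; apply: eq_bigr => j _; rewrite muln1.
Qed.

Lemma area_covers (a b a' b' : nat) (y : diagram) :
  covers a b y -> a <= a' -> b <= b' -> a * b <= area a' b' y.
Proof.
move=> covy leaa lebb.
have -> : a * b = area a' b' (fun i j => (i < a) && (j < b)).
  rewrite (@area_widen a b) //; last by move=> i j /andP[].
  rewrite /area (eq_bigr (fun _ => b)) ?sum_nat_const ?card_ord // => i _.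
  rewrite (eq_bigr (fun _ => 1)) ?sum1_card ?card_ord // => j _.
  by rewrite !ltn_ord.
apply: leq_sum => i _; apply: leq_sum => j _.
by case: (boolP (_ && _)) => // /andP[lia ljb]; rewrite covy.
Qed.

Lemma area_max (a b : nat) (y : diagram) : area a b y <= a * b.
Proof.
rewrite /area -[X in _ <= X * _]card_ord -sum_nat_const; apply: leq_sum => i _.
rewrite -[X in _ <= X]card_ord -sum1_card; apply: leq_sum => j _.
exact: leq_b1.
Qed.

(** * Filling a strip column by column *)

(* The weight of the first m cells of a strip with columns of height n, filled
   column by column. *)
Definition fill (n m : nat) : nat := \sum_(t < m) (t %% n + t %/ n).

Definition colfill (n m : nat) : diagram := fun i j => (i < n) && (j * n + i < m).

Lemma colfill_young (n m : nat) : young (colfill n m).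
Proof.
move=> i j i' j' lei lej /andP[ltin ltm]; rewrite /colfill (leq_ltn_trans lei) //=.
by apply: leq_ltn_trans ltm; rewrite leq_add // leq_mul2r lej orbT.
Qed.

Lemma colfill_inside (n c m : nat) : m <= n * c -> inside n c (colfill n m).
Proof.
move=> lem i j /andP[ltin ltm]; split=> //.
rewrite ltnNge; apply/negP => lecj.
by have : c * n <= j * n by [rewrite leq_mul2r lecj orbT]; lia.
Qed.

Lemma sum_colfill (n c m : nat) (f : nat -> nat -> nat) : m <= n * c ->
  \sum_(i < n) \sum_(j < c) colfill n m i j * f i j = \sum_(t < m) f (t %% n) (t %/ n).
Proof.
move=> lem; rewrite exchange_big.
(* The index [t = j * n + i] lists the cells column by column; the cutoff [t < m] sits inside [g] so
   that the range can be shortened afterwards. *)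
pose g t := (t < m) * f (t %% n) (t %/ n).
transitivity (\sum_(t < c * n) g t).
  rewrite sum_ord_blocks; apply: eq_bigr => j _; apply: eq_bigr => i _.
  have n0 : 0 < n by apply: leq_trans (ltn_ord i).
  rewrite /g /colfill ltn_ord modnMDl divnMDl // modn_small ?divn_small ?addn0 //.
rewrite (@sum_ord_widen m) ?[c * n]mulnC //.
  by apply: eq_bigr => t _; rewrite /g ltn_ord mul1n.
by move=> t; rewrite /g ltnNge => ->.
Qed.

Lemma weight_colfill (n c m : nat) : m <= n * c -> weight n c (colfill n m) = fill n m.
Proof. exact: (@sum_colfill n c m addn). Qed.

Lemma area_colfill (n c m : nat) : m <= n * c -> area n c (colfill n m) = m.
Proof.
move=> lem; have := sum_colfill (fun _ _ => 1) lem.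
rewrite sum1_card card_ord => e; rewrite -[RHS]e.
by apply: eq_bigr => i _; apply: eq_bigr => j _; rewrite muln1.
Qed.

(** Past the first full column, each of the [m] other cells lies one column further right than in a
    filling of its own. *)
Lemma fillD (n m : nat) : 0 < n -> fill n (n + m) = \sum_(i < n) i + m + fill n m.
Proof.
move=> n0; rewrite /fill big_split_ord /= -addnA; congr (_ + _).
  by apply: eq_bigr => i _; rewrite modn_small // divn_small // addn0.
have sum1 : \sum_(t < m) 1 = m by rewrite sum1_card card_ord.
rewrite -[X in _ = X + _]sum1 -big_split /=; apply: eq_bigr => t _.
by rewrite modnDl divnDl // divnn n0 addnCA.
Qed.

(** Closed form for [p] full columns and [q] more cells, doubled and with the negative terms on the
    left to stay in [nat]. The case [q = n] is allowed. *)
Lemma fillE (n p q : nat) : 0 < n -> q <= n ->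
  2 * fill n (p * n + q) + 2 * p * n + q = p * n * n + n * p * p + q * q + 2 * p * q.
Proof.
move=> n0 leq; elim: p => [|p IHp].
  have -> : fill n (0 * n + q) = \sum_(i < q) i.
    apply: eq_bigr => i _; have lti := leq_trans (ltn_ord i) leq.
    by rewrite modn_small // divn_small // addn0.
  by have := bin2_sqr q; rewrite -sum_ord_bin2; lia.
have -> : p.+1 * n + q = n + (p * n + q) by lia.
rewrite fillD //; have := bin2_sqr n; rewrite -sum_ord_bin2.
move: (fill _ _) IHp (\sum_(i < n) i) => F IHp S hS; nia.
Qed.

(** Write m = p n + q. With height n + 1, each of the p columns takes one cell from the remainder if
    p <= q; otherwise one column is broken up to supply them, which suffices because p <= n. The
    closed forms are then compared. *)
Lemma fill_mono (n m : nat) : m <= n * n -> fill n m <= fill n.+1 m.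
Proof.
case: (posnP n) => [->|n0 lem]; first by rewrite muln0 leqn0 => /eqP ->; rewrite /fill !big_ord0.
have := divn_eq m n; have := ltn_pmod m n0.
move: (m %/ n) (m %% n) => p q ltq em.
have lep : p <= n.
  by rewrite -(leq_pmul2r n0); apply: leq_trans lem; rewrite em leq_addr.
have := @fillE n p q n0 (ltnW ltq); rewrite -em.
case: (leqP p q) => [lepq|ltqp].
  have := @fillE n.+1 p (q - p) isT; have -> : p * n.+1 + (q - p) = m by lia.
  have [e eq] : exists e, q = p + e by exists (q - p); lia.
  have [g eg] : exists g, n = q + g by exists (n - q); lia.
  move: (fill n m) (fill n.+1 m) => F F'; rewrite eg eq addKn {em lem}; nia.
case: p lep ltqp em => // p lep ltqp em.
have := @fillE n.+1 p (n - p + q) isT; have -> : p * n.+1 + (n - p + q) = m by lia.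
have [g eg] : exists g, n = p.+1 + g by exists (n - p.+1); lia.
have [e eq] : exists e, p = q + e by exists (p - q); lia.
have -> : n - p = g.+1 by lia.
move: (fill n m) (fill n.+1 m) => F F'; rewrite eg eq {em lem}; nia.
Qed.

(** * Peeling full lines and the bound in a square box *)

Lemma young_tr (y : diagram) : young y -> young (transpose y).
Proof. by move=> Yy i j i' j' lei lej; apply: Yy. Qed.

Lemma inside_tr (a b : nat) (y : diagram) : inside a b y -> inside b a (transpose y).
Proof. by move=> iny i j /iny[]. Qed.

Lemma covers_tr (a b : nat) (y : diagram) : covers a b y -> covers b a (transpose y).
Proof. by move=> covy i j lti ltj; apply: covy. Qed.

Definition behead_col (y : diagram) : diagram := fun i j => y i j.+1.

Lemma behead_col_young (y : diagram) : young y -> young (behead_col y).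
Proof. by move=> Yy i j i' j' lei lej; apply: Yy. Qed.

Lemma behead_col_inside (a b : nat) (y : diagram) :
  inside a b.+1 y -> inside a b (behead_col y).
Proof. by move=> iny i j /iny[]. Qed.

Lemma behead_col_covers (a b : nat) (y : diagram) :
  covers a b.+1 y -> covers a b (behead_col y).
Proof. by move=> covy i j lti ltj; apply: covy. Qed.

Lemma sum_behead_col (n b : nat) (y : diagram) (f : nat -> nat -> nat) :
  covers n 1 y ->
  \sum_(i < n) \sum_(j < b.+1) y i j * f i j =
  \sum_(i < n) f i 0 + \sum_(i < n) \sum_(j < b) behead_col y i j * f i j.+1.
Proof.
move=> covy; rewrite -big_split /=; apply: eq_bigr => i _.
by rewrite big_ord_recl /= covy // mul1n.
Qed.

Lemma area_behead_col (n b : nat) (y : diagram) : covers n 1 y ->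
  area n b.+1 y = n + area n b (behead_col y).
Proof.
move=> /(@sum_behead_col n b y (fun _ _ => 1)); rewrite sum1_card card_ord => e.
rewrite /area -[in RHS](eq_bigr _ (fun i _ => eq_bigr _ (fun j _ => muln1 _))) -e.
by apply: eq_bigr => i _; apply: eq_bigr => j _; rewrite muln1.
Qed.

Lemma weight_behead_col (n b : nat) (y : diagram) : covers n 1 y ->
  weight n b.+1 y = \sum_(i < n) i + area n b (behead_col y) + weight n b (behead_col y).
Proof.
move=> covy; rewrite /weight (sum_behead_col b addn covy) -addnA; congr (_ + _).
  by apply: eq_bigr => i _; rewrite addn0.
rewrite -big_split; apply: eq_bigr => i _; rewrite -big_split; apply: eq_bigr => j _ /=.
by rewrite addnS mulnS.
Qed.

Variant square_spec (n : nat) (y : diagram) : Prop :=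
  | FullCol of covers n.+1 1 y
  | FullRow of covers n.+1 1 (transpose y)
  | SmallerSquare of inside n n y.

(** Two end cells decide: [y n 0] forces a full first column, [y 0 n] a full first row, and without
    both no cell reaches the last row or column. *)
Lemma squareP (n : nat) (y : diagram) :
  young y -> inside n.+1 n.+1 y -> square_spec n y.
Proof.
move=> Yy iny.
case: (boolP (y n 0)) => [yn0|nyn0].
  by apply: FullCol => i j lti; rewrite ltnS leqn0 => /eqP ->; apply: Yy yn0.
case: (boolP (y 0 n)) => [y0n|ny0n].
  by apply: FullRow => i j lti; rewrite ltnS leqn0 => /eqP ->; apply: Yy y0n.
apply: SmallerSquare => i j yij; split; rewrite ltnNge; apply/negP => le.
  by case/negP: nyn0; apply: Yy yij.
by case/negP: ny0n; apply: Yy yij.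
Qed.

Lemma weight_le_fill (n : nat) (y : diagram) :
  young y -> inside n n y -> weight n n y <= fill n (area n n y).
Proof.
elim: n y => [|n IHn] y; first by rewrite /weight big_ord0.
(* The inner induction is on the area: removing a full line leaves a smaller diagram that is still
   viewed in the same square. *)
have [m] := ubnP (area n.+1 n.+1 y); elim: m y => // m IHm y ltm Yy iny.
(* Removing a full column changes [weight] and [fill] by the same amount. The claim is for any [z],
   so that the transpose settles a full row. *)
have full z : area n.+1 n.+1 z < m.+1 -> young z -> inside n.+1 n.+1 z ->
    covers n.+1 1 z -> weight n.+1 n.+1 z <= fill n.+1 (area n.+1 n.+1 z).
  move=> ltz Yz inz cz; move: ltz; rewrite area_behead_col // weight_behead_col //.
  have inz' := behead_col_inside inz.
  have inz'' : inside n.+1 n.+1 (behead_col z) by move=> i j /inz'[? ?]; split=> //; exact: leqW.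
  have wid := area_widen inz' (leqnn _) (leqnSn _).
  rewrite -wid -(weight_widen inz' (leqnn _) (leqnSn _)) => ltz.
  rewrite fillD // leq_add2l; apply: IHm => //; first by lia.
  exact: behead_col_young.
case: (squareP Yy iny) => [c|c|iny'].
- exact: full.
- rewrite -weight_tr -area_tr; apply: full => //; first by rewrite area_tr.
    exact: young_tr.
  exact: inside_tr.
rewrite (weight_widen iny') // (area_widen iny') //.
by apply: leq_trans (IHn _ Yy iny') _; apply/fill_mono/area_max.
Qed.

(** * Confining a diagram to fewer columns *)

(** Both fillings contain a full rectangle with sides n and k, of equal weight. The [q] further
    cells lie in column [k] on the left and in column [n] on the right. *)
Lemma fill_rect_tr (n k q : nat) : k <= n -> q <= k ->
  fill n (n * k + q) <= fill k (n * k + q).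
Proof.
move=> lekn leqk; case: (posnP k) => [k0|k0].
  by move: leqk; rewrite k0 leqn0 muln0 => /eqP->; rewrite /fill !big_ord0.
have := @fillE n k q (leq_trans k0 lekn) (leq_trans leqk lekn).
have := @fillE k n q k0 leqk; rewrite [k * n]mulnC.
move: (fill _ _) (fill _ _) => F F'.
have : 2 * k * q <= 2 * n * q by rewrite leq_mul2r leq_mul2l lekn !orbT.
nia.
Qed.

(* The covered rectangle a * b may be shortened on either side as full rows or
   columns are peeled off; only a + b is traded against l + k. *)
Lemma confine (n k l a b : nat) (y : diagram) :
  young y -> inside n n y -> covers a b y ->
  a + b = l + k -> k <= a -> k <= b -> area n n y <= n * k ->
  exists z, [/\ young z, inside n k z, covers l k z, area n k z = area n n y
    & weight n n y <= weight n k z].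
Proof.
elim: n y k l a b => [|n IHn] y k l a b Yy iny covy eab leka lekb ley.
  have k0 : k = 0.
    apply/eqP; rewrite -leqn0 leqNgt; apply/negP => k0.
    by case: (iny 0 0 (covy 0 0 (leq_trans k0 leka) (leq_trans k0 lekb))).
  exists (fun _ _ => false); split=> //; first by move=> i j; rewrite k0.
  - by rewrite /area !big_ord0.
  - by rewrite /weight !big_ord0.
elim: k y l a b Yy iny covy eab leka lekb ley => [|k IHk] y l a b Yy iny covy eab leka lekb ley.
  exists (fun _ _ => false); split=> //.
    by transitivity 0; [rewrite /area big1 // => i _; rewrite big_ord0 | lia].
  have := weight_le_fill Yy iny; have -> : area n.+1 n.+1 y = 0 by lia.
  by rewrite /fill big_ord0 leqn0 => /eqP ->.
have le_sq i j : i < a -> j < b -> i < n.+1 /\ j < n.+1.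
  by move=> lti ltj; apply/iny/covy.
have lean : a <= n.+1 by case: (a) (b) leka lekb le_sq => // a' [|b'] // _ _ /(_ a' 0); lia.
have lebn : b <= n.+1 by case: (a) (b) leka lekb le_sq => [|a'] // [|b'] // _ _ /(_ 0 b'); lia.
have leab := area_covers covy lean lebn.
(* For a fixed sum and both factors at least [k.+1], the product [a * b] is least at [l * k.+1]; the
   area bound then limits [l]. A full column put back thus covers all [l] rows. *)
have leln : l <= n.+1.
  rewrite -(leq_pmul2r (isT : 0 < k.+1)); apply: leq_trans ley; apply: leq_trans leab.
  have [e ea] : exists e, a = k.+1 + e by exists (a - k.+1); lia.
  have [g eg] : exists g, b = k.+1 + g by exists (b - k.+1); lia.
  have -> : l = k.+1 + e + g by lia.
  by rewrite ea eg; nia.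
have full z a' b' : young z -> inside n.+1 n.+1 z -> covers a' b' z ->
    a' + b' = l + k.+1 -> k.+1 <= a' -> k.+1 <= b' -> area n.+1 n.+1 z <= n.+1 * k.+1 ->
    covers n.+1 1 z ->
    exists z', [/\ young z', inside n.+1 k.+1 z', covers l k.+1 z',
      area n.+1 k.+1 z' = area n.+1 n.+1 z & weight n.+1 n.+1 z <= weight n.+1 k.+1 z'].
  move=> Yz inz; case: b' => // b' covz eab' leka' lekb' lez cz.
  have inz' := behead_col_inside inz.
  have inz'' : inside n.+1 n.+1 (behead_col z) by move=> i j /inz'[? ?]; split=> //; exact: leqW.
  have wid := area_widen inz' (leqnn _) (leqnSn _).
  have ea := @area_behead_col n.+1 n z cz.
  have eab'' : a' + b' = l + k by lia.
  have lez' : area n.+1 n.+1 (behead_col z) <= n.+1 * k by rewrite wid; lia.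
  have [t [Yt int covt at_ wt]] := IHk _ l a' b' (behead_col_young Yz) inz''
    (behead_col_covers covz) eab'' (ltnW leka') lekb' lez'.
  (* The peeled column is put back in front of the confined remainder. *)
  pose z' i j := (i < n.+1) && (if j is j'.+1 then t i j' else true).
  have cz' : covers n.+1 1 z' by move=> i [|j] //= lti _; rewrite /z' lti.
  have ez' : forall i j, i < n.+1 -> j < k -> behead_col z' i j = t i j.
    by move=> i j lti _; rewrite /behead_col /z' lti.
  exists z'; split.
  - move=> i j i' j' lei lej /andP[lti tij]; rewrite /z' (leq_ltn_trans lei) //=.
    by case: j j' lej tij => [|j] [|j'] //= lej; apply: Yt.
  - by move=> i [|j] /andP[lti] //= /int[].
  - by move=> i [|j] lti ltj; rewrite /z' (leq_trans lti) //; apply: covt.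
  - by rewrite area_behead_col // ea (eq_area ez') at_ wid.
  rewrite !weight_behead_col // (eq_area ez') (eq_weight ez') at_ -wid leq_add2l.
  by rewrite -(weight_widen inz' (leqnn _) (leqnSn _)).
case: (squareP Yy iny) => [c|c|iny'].
- exact: (full y a b).
(* The hypotheses are symmetric in [a] and [b], and the result for the transpose needs no
   transposing back: only area and weight are compared with [y]. *)
- have := full (transpose y) b a (young_tr Yy) (inside_tr iny) (covers_tr covy).
  rewrite area_tr weight_tr; apply=> //; lia.
rewrite (weight_widen iny') // (area_widen iny') //.
have lean' : a <= n.
  by case: (a) (b) leka lekb covy => // a' [|b'] // _ _ /(_ a' 0) h; case: (iny' a' 0); auto.
have lebn' : b <= n.
  by case: (a) (b) leka lekb covy => [|a'] // [|b'] // _ _ /(_ 0 b') h; case: (iny' 0 b'); auto.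
have lek : k.+1 <= n by lia.
rewrite (area_widen iny') // in ley.
case: (leqP (area n n y) (n * k.+1)) => [le|lt].
  have [z [Yz inz covz az wz]] := IHn _ _ _ _ _ Yy iny' covy eab leka lekb le.
  exists z; rewrite (area_widen inz) // (weight_widen inz) //; split=> //.
  by move=> i j /inz[? ?]; split=> //; exact: leqW.
rewrite (area_widen iny') // in leab.
set m := area n n y in ley lt leab *.
have lem : m <= k.+1 * n.+1 by lia.
(* Rows of length [k.+1]: [n] full ones, then the remaining [m - n * k.+1] cells. They cover [l]
   rows since [l * k.+1 <= a * b <= m]. *)
exists (transpose (colfill k.+1 m)); split.
- exact/young_tr/colfill_young.
- exact/inside_tr/colfill_inside.
- move=> i j lti ltj; rewrite /transpose /colfill ltj /=; nia.
- by rewrite area_tr area_colfill.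
rewrite weight_tr weight_colfill //; apply: leq_trans (weight_le_fill Yy iny') _.
rewrite -/m; have -> : m = n * k.+1 + (m - n * k.+1) by lia.
by apply: fill_rect_tr; lia.
Qed.

(** * A rectangle with a diagram below it *)

Definition stack (l k : nat) (y : diagram) : diagram :=
  fun i j => if i < l then j < k else y (i - l) j.

Lemma stack_young (a l k : nat) (y : diagram) :
  young y -> inside a k y -> young (stack l k y).
Proof.
move=> Yy iny i j i' j' lei lej; rewrite /stack.
case: (ltnP i l) => [lti|leli].
  by rewrite (leq_ltn_trans lei lti) => ltj; apply: leq_ltn_trans ltj.
case: (ltnP i' l) => [lti'|leli'] yij; first by apply: leq_ltn_trans lej _; case: (iny _ _ yij).
by apply: Yy yij => //; apply: leq_sub2r.
Qed.

Lemma stack_inside (a l k : nat) (y : diagram) :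
  inside a k y -> inside (l + a) k (stack l k y).
Proof.
move=> iny i j; rewrite /stack; case: (ltnP i l) => [lti ltj|leli /iny[? ?]]; last by lia.
by split=> //; apply: leq_trans lti (leq_addr _ _).
Qed.

Lemma stack_drop (a l k : nat) (y : diagram) : inside a k y -> covers l k y ->
  forall i j, j < k -> y i j = stack l k (fun i j => y (l + i) j) i j.
Proof.
move=> iny covy i j ltj; rewrite /stack; case: (ltnP i l) => [lti|leli]; last by rewrite subnKC.
by rewrite ltj covy.
Qed.

Lemma area_stack (a l k : nat) (y : diagram) :
  area (l + a) k (stack l k y) = k * l + area a k y.
Proof.
rewrite /area big_split_ord /=; congr (_ + _).
  rewrite (eq_bigr (fun _ => k)); first by rewrite sum_nat_const card_ord mulnC.
  move=> i _; rewrite -[RHS]card_ord -sum1_card; apply: eq_bigr => j _.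
  by rewrite /stack !ltn_ord.
apply: eq_bigr => i _; apply: eq_bigr => j _.
by rewrite /stack ltnNge leq_addr addKn.
Qed.

(** Moving [y] down by [l] rows adds [l] per cell. For a given area, only the weight of [y] itself
    remains to be maximised. *)
Lemma weight_stack (a l k : nat) (y : diagram) :
  weight (l + a) k (stack l k y) =
  weight l k (fun _ _ => true) + l * area a k y + weight a k y.
Proof.
rewrite {1}/weight big_split_ord /= -addnA; congr (_ + _).
  by apply: eq_bigr => i _; apply: eq_bigr => j _; rewrite /stack !ltn_ord.
rewrite big_distrr -big_split; apply: eq_bigr => i _.
rewrite big_distrr -big_split; apply: eq_bigr => j _ /=.
by rewrite /stack ltnNge leq_addr addKn -addnA mulnDr [l * _]mulnC.
Qed.

(** * The number of 2-stars in the extremal graphs *)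

Lemma deg_sum (G : sgraph) (v : G) : deg v = \sum_(w : G) adj v w.
Proof.
rewrite /deg -sum1_card big_mkcond; apply: eq_bigr => w _.
by rewrite inE; case: (adj v w).
Qed.

(** Rows and columns of a Young diagram are initial segments: the summand [j] along a row gives the
    2-stars centred at a u-vertex, the summand [i] along a column those centred at a w-vertex. *)
Lemma num_copies_bip_graph (r s : nat) (E : nat -> nat -> bool) (y : diagram) :
  young y -> (forall i j, i < r -> j < s -> E i.+1 j.+1 = y i j) ->
  num_copies (star 2) (bip_graph r s E) = weight r s y.
Proof.
move=> Yy eE; rewrite num_copies_star2 big_sumType /=.
rewrite (eq_bigr (fun i : 'I_r => \sum_(j < s) y i j * j)); last first.
  move=> i _; rewrite deg_sum big_sumType /= big1 ?add0n //.
  rewrite -(@bin2_sum_prefix s (fun j => y i j)); last by move=> j j' lej; apply: Yy.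
  by congr 'C(_, 2); apply: eq_bigr => j _; rewrite eE.
rewrite [X in _ + X](eq_bigr (fun j : 'I_s => \sum_(i < r) y i j * i)); last first.
  move=> j _; rewrite deg_sum big_sumType /= [X in _ + X]big1 ?addn0 //.
  rewrite -(@bin2_sum_prefix r (fun i => y i j)); last by move=> i i' lei; apply: Yy.
  by congr 'C(_, 2); apply: eq_bigr => i _; rewrite eE.
rewrite addnC exchange_big -big_split; apply: eq_bigr => i _.
by rewrite -big_split; apply: eq_bigr => j _; rewrite /= -mulnDr.
Qed.

(** The column order is lexicographic in [(j, i)]; this translates [colfill] into the quotient and
    remainder form of the graph definitions. *)
Lemma ltn_divmod (n i j m : nat) : i < n ->
  (j * n + i < m) = (j < m %/ n) || ((j == m %/ n) && (i < m %% n)).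
Proof.
move=> ltin; have n0 : 0 < n by apply: leq_trans ltin.
have := divn_eq m n; have := ltn_pmod m n0.
move: (m %/ n) (m %% n) => p q ltq ->.
case: (ltngtP j p) => [ltjp|ltpj|->] /=.
- have : j.+1 * n <= p * n by rewrite leq_mul2r ltjp orbT.
  by rewrite mulSn; lia.
- have : p.+1 * n <= j * n by rewrite leq_mul2r ltpj orbT.
  by rewrite mulSn; lia.
by rewrite ltn_add2l.
Qed.

Lemma num_copies_B (r s m : nat) : m <= r * s ->
  num_copies (star 2) (B r s m) = fill r m.
Proof.
move=> lem; rewrite -(weight_colfill lem); apply: num_copies_bip_graph.
  exact: colfill_young.
by move=> i j lti ltj; rewrite /colfill lti ltn_divmod.
Qed.

Lemma num_copies_B1 (r s m l k : nat) : l < r -> k <= s -> k * l <= m -> m <= r * k ->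
  num_copies (star 2) (B1 r s m l k) =
  weight l k (fun _ _ => true) + l * (m - k * l) + fill (r - l) (m - k * l).
Proof.
move=> ltlr leks leklm lem; set x := m - k * l; set a := r - l.
have lex : x <= a * k by rewrite /x /a mulnBl; lia.
have inx := colfill_inside lex.
rewrite -{1}(area_colfill lex) -(weight_colfill lex) -weight_stack.
have er : l + a = r by rewrite /a; lia.
rewrite -(weight_widen (stack_inside inx) (leqnn _) leks) er.
apply: num_copies_bip_graph; first exact: (@stack_young a l k _ (@colfill_young a x) inx).
move=> i j lti ltj; rewrite /stack /colfill -/x -/a.
have a0 : 0 < a by rewrite /a; lia.
have := divn_eq x a; have := ltn_pmod x a0.
move: (x %/ a) (x %% a) (fun i => @ltn_divmod a i j x) => p q ldm ltq ex.
(* In the boundary case [p = k] the remainder vanishes, in agreement with the guard [p != k] in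
   [B1]. *)
have lepk : p < k \/ p = k /\ q = 0.
  case: (ltnP p k) => [|lekp]; first by left.
  have : k * a <= p * a by rewrite leq_mul2r lekp orbT.
  rewrite [k * a]mulnC => le2; right; suff -> : p = k by lia.
  apply/eqP; rewrite eqn_leq lekp andbT -(leq_pmul2r a0) [k * a]mulnC.
  by apply: leq_trans lex; rewrite ex leq_addr.
case: (ltnP i l) => [ltil|leli]; first by lia.
have lta : i - l < a by rewrite /a; lia.
by rewrite lta ldm //=; lia.
Qed.

Lemma num_copies_B2 (r s m l k : nat) : l <= r -> 0 < k -> k <= s -> k * l <= m -> m <= r * k ->
  num_copies (star 2) (B2 r s m l k) =
  weight l k (fun _ _ => true) + l * (m - k * l) + fill k (m - k * l).
Proof.
move=> ltlr k0 leks leklm lem; set x := m - k * l; set a := r - l.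
have lex : x <= k * a by rewrite /x /a mulnBr; lia.
have inx := inside_tr (colfill_inside lex).
rewrite -{1}(area_colfill lex) -(weight_colfill lex).
rewrite -area_tr -(weight_tr k a (colfill k x)) -weight_stack.
have er : l + a = r by rewrite /a; lia.
rewrite -(weight_widen (stack_inside inx) (leqnn _) leks) er.
apply: num_copies_bip_graph.
  exact: (@stack_young a l k _ (young_tr (@colfill_young k x)) inx).
move=> i j lti ltj; rewrite /stack /transpose /colfill -/x.
move: (x %/ k) (x %% k) (ltn_pmod x k0) (fun j => @ltn_divmod k j (i - l) x) => p q ltq ldm.
case: (ltnP i l) => [ltil|leli]; first by lia.
by case: (ltnP j k) => [ltjk|lekj]; [rewrite ldm //= | ]; lia.
Qed.

(** * Bipartite graphs and their degree diagrams *)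

Lemma sum_ltn (n c : nat) : c <= n -> \sum_(i < n) (i < c) = c.
Proof.
move=> lec; rewrite (@sum_ord_widen c n (fun i => i < c)) //.
  by rewrite (eq_bigr (fun _ => 1)) ?sum1_card ?card_ord // => i _; rewrite ltn_ord.
by move=> i; rewrite ltnNge => ->.
Qed.

Lemma sum_ltn_mul (n c : nat) : c <= n -> \sum_(i < n) (i < c) * i = 'C(c, 2).
Proof.
move=> lec; rewrite -(@bin2_sum_prefix n (fun i => i < c)) ?sum_ltn //.
by move=> i j lei; apply: leq_ltn_trans.
Qed.

Lemma bipartition_sym (G : sgraph) (U W : {set G}) : bipartition U W -> bipartition W U.
Proof.
case=> UW dUW eUW; split; first by rewrite setUC.
  by rewrite disjoint_sym.
by move=> x y /eUW[]; [right | left].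
Qed.

Lemma bipartition_notin (G : sgraph) (U W : {set G}) (v : G) : bipartition U W ->
  (v \in W) = (v \notin U).
Proof.
case=> UW dUW _; have := in_setT v; rewrite -UW inE.
case: (boolP (v \in U)) => //= vU _.
by apply/negbTE; rewrite (disjointFr dUW vU).
Qed.

Lemma bipartition_deg (G : sgraph) (U W : {set G}) (u : G) : bipartition U W -> u \in U ->
  deg u = \sum_(w in W) adj u w.
Proof.
move=> bUW uU; rewrite /deg -sum1_card big_mkcond [RHS]big_mkcond; apply: eq_bigr => w _.
rewrite inE; case: (boolP (adj u w)) => [auw|]; last by case: ifP.
have [_ _ /(_ _ _ auw)[[_ ->]//|[uW _]]] := bUW.
by rewrite (bipartition_notin _ bUW) uU in uW.
Qed.

Lemma bipartition_edges (G : sgraph) (U W : {set G}) : bipartition U W ->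
  #|edges G| = \sum_(u in U) deg u.
Proof.
move=> bUW; have [_ dUW eUW] := bUW.
rewrite (eq_bigr (fun u => \sum_(w in W) adj u w)); last by move=> u; apply: bipartition_deg.
rewrite pair_big_dep /=.
(* Every edge has exactly one orientation from [U] to [W], so edges are counted as ordered pairs. *)
pose D := [set p : G * G | (p.1 \in U) && (p.2 \in W) && adj p.1 p.2].
transitivity #|D|; last first.
  rewrite -sum1_card /D big_mkcond [RHS]big_mkcond; apply: eq_bigr => p _.
  by rewrite inE; case: (_ \in U); case: (_ \in W); case: (adj _ _).
rewrite -(@card_in_imset _ _ (fun p : G * G => [set p.1; p.2]) D).
  apply: eq_card => e; rewrite inE; apply/existsP/imsetP.
    case=> x /existsP[y /andP[axy /eqP->]].
    case: (eUW _ _ axy) => -[xin yin].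
      by exists (x, y); rewrite // inE /= xin yin.
    by exists (y, x); rewrite 1?setUC // inE /= xin yin adj_sym.
  case=> -[x y]; rewrite inE /= => /andP[_ axy] ->.
  by exists x; apply/existsP; exists y; rewrite axy eqxx.
move=> [u w] [u' w']; rewrite !inE /= => /andP[/andP[uU wW] _] /andP[/andP[uU' wW'] _] e.
have : u \in [set u'; w'] by rewrite -e set21.
have : w \in [set u'; w'] by rewrite -e set22.
rewrite !inE => /orP[/eqP ew|/eqP ->].
  by rewrite (bipartition_notin _ bUW) ew uU' in wW.
case/orP=> /eqP eu; first by rewrite eu.
by rewrite (bipartition_notin _ bUW) -eu uU in wW'.
Qed.

Lemma min_deg_le (G : sgraph) (S : {set G}) (v : G) : v \in S -> min_deg S <= deg v.
Proof.
rewrite /min_deg => vS; elim: (index_enum _) (mem_index_enum v) => // x s IHs.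
rewrite inE big_cons => /predU1P[<-|/IHs le]; first by rewrite vS geq_minl.
by case: ifP => // _; rewrite geq_min le orbT.
Qed.

(** The Ferrers diagram of the degrees in [U]; its column heights form the conjugate partition. *)
Definition profile (G : sgraph) (U : {set G}) : diagram :=
  fun i j => i < #|[set u in U | j < deg u]|.

Section Profile.
Variables (G : sgraph) (U W : {set G}).
Hypothesis bUW : bipartition U W.

Let c (j : nat) : nat := #|[set u in U | j < deg u]|.

Let c_sum (j : nat) : c j = \sum_(u in U) (j < deg u).
Proof.
rewrite /c -sum1_card big_mkcond [RHS]big_mkcond; apply: eq_bigr => u _.
by rewrite inE; case: (u \in U); case: (j < _).
Qed.

Let c_le (j : nat) : c j <= #|U|.
Proof. by apply/subset_leq_card/subsetP => u; rewrite inE => /andP[]. Qed.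

Let deg_le (u : G) : u \in U -> deg u <= #|W|.
Proof.
by move=> uU; rewrite (bipartition_deg bUW uU) -sum1_card; apply: leq_sum => w _; apply: leq_b1.
Qed.

Lemma profile_young : young (profile U).
Proof.
move=> i j i' j' lei lej; rewrite /profile => lti.
apply: leq_ltn_trans lei (leq_trans lti _).
apply/subset_leq_card/subsetP => u; rewrite !inE => /andP[-> ltj].
exact: leq_ltn_trans ltj.
Qed.

Lemma profile_inside : inside #|U| #|W| (profile U).
Proof.
move=> i j lti; split; first exact: leq_trans lti (c_le j).
have /card_gt0P[u] := leq_ltn_trans (leq0n _) lti.
by rewrite inE => /andP[uU ltj]; apply: leq_trans ltj (deg_le uU).
Qed.

Lemma profile_covers (I : {set G}) (k : nat) :
  I \subset U -> k <= min_deg I -> covers #|I| k (profile U).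
Proof.
move=> /subsetP IU lek i j lti ltj; apply: leq_trans lti _.
apply/subset_leq_card/subsetP => u uI; rewrite inE IU //=.
apply: leq_trans ltj (leq_trans lek _).
exact: min_deg_le.
Qed.

Lemma area_profile : area #|U| #|W| (profile U) = #|edges G|.
Proof.
rewrite /area exchange_big (bipartition_edges bUW) /=.
rewrite (eq_bigr (fun j : 'I__ => \sum_(u in U) (j < deg u))); last first.
  by move=> j _; rewrite sum_ltn ?c_le // -c_sum.
rewrite exchange_big; apply: eq_bigr => u uU.
by rewrite sum_ltn ?deg_le.
Qed.

(** Both sides expand over pairs [u], [u'] in [U]: the left counts common neighbours, the right the
    indices [j] below both degrees, exactly [minn (deg u) (deg u')] of them. *)
Let sum_c2 : \sum_(w in W) deg w * deg w <= \sum_(j < #|W|) c j * c j.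
Proof.
have bWU := bipartition_sym bUW.
have sqr I (P : pred I) (r : seq I) (f : I -> nat) :
    (\sum_(i <- r | P i) f i) * (\sum_(i <- r | P i) f i) = \sum_(i <- r | P i) \sum_(i' <- r | P i') f i * f i'.
  by rewrite big_distrl; apply: eq_bigr => i _; rewrite big_distrr.
rewrite (eq_bigr (fun w => \sum_(u in U) \sum_(u' in U) adj w u * adj w u')); last first.
  by move=> w wW; rewrite (bipartition_deg bWU wW) sqr.
rewrite [X in _ <= X](eq_bigr (fun j : 'I__ =>
    \sum_(u in U) \sum_(u' in U) (j < deg u) * (j < deg u'))); last first.
  by move=> j _; rewrite c_sum sqr.
rewrite exchange_big [X in _ <= X]exchange_big; apply: leq_sum => u uU.
rewrite exchange_big [X in _ <= X]exchange_big; apply: leq_sum => u' uU' /=.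
apply: (@leq_trans (minn (deg u) (deg u'))).
  rewrite leq_min (bipartition_deg bUW uU) (bipartition_deg bUW uU').
  by apply/andP; split; apply: leq_sum => w _; rewrite ![adj w _]adj_sym;
    case: (adj u w); case: (adj u' w).
rewrite -{1}(@sum_ltn #|W| (minn (deg u) (deg u'))); last by rewrite geq_min deg_le.
by apply: leq_sum => j _; rewrite leq_min; case: (j < deg u); case: (j < deg u').
Qed.

Lemma num_copies_le_profile :
  num_copies (star 2) G <= weight #|U| #|W| (profile U).
Proof.
rewrite num_copies_star2 (bigID (mem U)) /=.
rewrite [X in _ + X](eq_bigl (mem W)); last by move=> v; rewrite /= (bipartition_notin _ bUW).
have -> : weight #|U| #|W| (profile U) = \sum_(u in U) 'C(deg u, 2) + \sum_(j < #|W|) 'C(c j, 2).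
  transitivity (\sum_(i < #|U|) \sum_(j < #|W|) profile U i j * j
     + \sum_(i < #|U|) \sum_(j < #|W|) profile U i j * i).
    rewrite -big_split; apply: eq_bigr => i _; rewrite -big_split.
    by apply: eq_bigr => j _; rewrite /= -mulnDr addnC.
  rewrite exchange_big [X in _ + X]exchange_big /=; congr (_ + _); last first.
    by apply: eq_bigr => j _; rewrite sum_ltn_mul ?c_le.
  rewrite (eq_bigr (fun j : 'I__ => \sum_(u in U) (j < deg u) * j)); last first.
    by move=> j _; rewrite -big_distrl sum_ltn ?c_le // -/(c j) c_sum big_distrl.
  by rewrite exchange_big; apply: eq_bigr => u uU; rewrite sum_ltn_mul ?deg_le.
(* The degrees in [W] and the heights [c j] both sum to the number of edges. Doubling and adding
   that number turns the binomials into squares. *)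
rewrite leq_add2l -(leq_pmul2r (isT : 0 < 2)) -(leq_add2r #|edges G|).
rewrite {1}(bipartition_edges (bipartition_sym bUW)).
rewrite -area_profile /area exchange_big /=.
rewrite [X in _ <= _ + X](eq_bigr (fun j : 'I__ => c j)); last first.
  by move=> j _; rewrite sum_ltn ?c_le.
rewrite !big_distrl -!big_split /= (eq_bigr _ (fun v _ => bin2_sqr (deg v))).
by rewrite [X in _ <= X](eq_bigr _ (fun j _ => bin2_sqr (c (nat_of_ord j)))).
Qed.

End Profile.

(** * The upper bounds *)

(** After [confine] with [a = l] and [b = k], the box bound applies to the part below the rectangle.
    The side [n] of the box stays free: [r - l] serves [B1], and [k] serves [B2]. *)
Lemma weight_le_base_fill (r s k l n : nat) (y : diagram) :
  young y -> inside r s y -> s <= r -> covers l k y -> k <= l -> l <= r ->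
  area r s y <= r * k -> r - l <= n -> k <= n ->
  weight r s y <= weight l k (fun _ _ => true)
    + l * (area r s y - k * l) + fill n (area r s y - k * l).
Proof.
move=> Yy iny lesr covy lekl lelr; set m := area r s y => lem lerl lekn.
have iny' : inside r r y by move=> i j /iny[? ltj]; split=> //; apply: leq_trans lesr.
have em : area r r y = m by rewrite (area_widen iny).
have [|z [Yz inz covz az wz]] := confine Yy iny' covy erefl lekl (leqnn k); first by rewrite em.
rewrite -(weight_widen iny (leqnn r) lesr); apply: leq_trans wz _.
set w : diagram := fun i j => z (l + i) j.
have Yw : young w by move=> i j i' j' lei lej; apply: Yz; rewrite ?leq_add2l.
have inw : inside (r - l) k w by move=> i j /inz[]; lia.
have er : l + (r - l) = r by rewrite subnKC.
have ez i j : i < r -> j < k -> z i j = stack l k w i j by move=> _; apply: stack_drop inz covz i j.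
have aw : area (r - l) k w = m - k * l.
  by rewrite -em -az (eq_area ez) -{2}er area_stack addKn.
rewrite (eq_weight ez) -{1}er weight_stack aw leq_add2l.
rewrite -aw -(weight_widen inw lerl lekn) -(area_widen inw lerl lekn).
by apply: weight_le_fill => // i j /inw[]; lia.
Qed.

Theorem theorem1p7 (r s l k m : nat) (G : sgraph) (U W : {set G}) :
  0 < r -> 0 < s -> 0 < l -> 0 < k -> 0 < m ->
  s <= r -> k <= l -> l <= r -> k <= s ->
  k * l <= m -> m <= r * s ->
  bipartition U W -> #|U| = r -> #|W| = s -> #|edges G| = m ->
  (exists I : {set G}, [/\ I \subset U, #|I| = l & k <= min_deg I]) ->
  [/\ m <= r * k -> k + l <= r ->
        num_copies (star 2) G <= num_copies (star 2) (B1 r s m l k),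
      m <= r * k -> r < k + l ->
        num_copies (star 2) G <= num_copies (star 2) (B2 r s m l k)
    & r * k <= m ->
        num_copies (star 2) G <= num_copies (star 2) (B r s m)].
Proof.
move=> _ _ _ k0 _ lesr lekl lelr leks leklm lem bUW cU cW cE [I [IU cI lekI]].
have := num_copies_le_profile bUW; have := area_profile bUW.
have := profile_inside bUW; have := profile_covers IU lekI.
rewrite cI cU cW cE => covy iny ay leN; have Yy := @profile_young G U.
have base n : m <= r * k -> r - l <= n -> k <= n -> num_copies (star 2) G
    <= weight l k (fun _ _ => true) + l * (m - k * l) + fill n (m - k * l).
  rewrite -ay => *; apply: leq_trans leN _; exact: weight_le_base_fill.
split=> [lemk lerkl|lemk ltrkl|lerkm].
- by rewrite num_copies_B1 //; [apply: base => // | ]; lia.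
- by rewrite num_copies_B2 //; apply: base => //; lia.
(* Here the box bound in the square of side [r] is already enough. *)
rewrite num_copies_B //; apply: leq_trans leN _.
rewrite -(weight_widen iny (leqnn r) lesr) -ay -(area_widen iny (leqnn r) lesr).
by apply: weight_le_fill => // i j /iny[]; lia.
Qed.
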